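(* For any $m\in\mathbb{N}$ and any $\nu=(q_0,\dots,q_m)\in(\mathbb{N}\setminus\{0\})^{m+1}$, and for every $t\ge0$, $e^{-\lambda_\nu t}$ with $\lambda_\nu=\sum_{i=0}^m(\mu_{q_i}-\mu_0)$ is an eigenvalue of the Koopman operator $\mathcal{K}^t_{\mathcal B}$ of the Burgers flow, with associated eigen-observable $$\varphi_\nu=\prod_{i=0}^m\frac{c_{q_i}\circ H}{c_0\circ H}\in\mathcal{F},$$ that is, $\mathcal{K}^t_{\mathcal B}(\varphi_\nu)=e^{-\lambda_\nu t}\varphi_\nu$.
   Context: $V:[0,1]\to\mathbb{R}$ is a fixed smooth, strictly positive function; $\mathbb{N}=\{0,1,2,\dots\}$. The Burgers flow $\Phi^t_{\mathcal B}$ on $L^2([0,1])$ is defined by $\Phi^t_{\mathcal B}(u_0)=u(t,\cdot)$, where $u$ is the solution (continuous in $t\ge0$ with values in $L^2([0,1])$, infinitely differentiable in $x$ and satisfying the equation and boundary conditions classically for $t>0$) of $$\partial_tu+u\,\partial_xu=\partial^2_{xx}u+2\partial_xV,\qquad u(t,0)=u(t,1)=0,\qquad u(0,x)=u_0(x).$$ $\mathcal{F}$ is the set of continuous maps from $L^2([0,1])$ to $\mathbb{R}$ (observables), and the Koopman operators act on $\mathcal{F}$ by $(\mathcal{K}^t_{\mathcal B}(\phi))(u_0)=\phi(\Phi^t_{\mathcal B}(u_0))$, $t\ge0$. The operator $A=-\partial^2_{xx}+V$ on $[0,1]$ with Neumann boundary conditions is self-adjoint, with eigenvalues $0<\mu_0<\mu_1\le\mu_2\le\dots$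 and a complete orthonormal family $(e_n)_{n\in\mathbb{N}}$ in $L^2([0,1])$ of real eigenfunctions: $-\partial_{xx}^2e_n+Ve_n=\mu_ne_n$, $\partial_xe_n(0)=\partial_xe_n(1)=0$, with $e_0>0$ on $[0,1]$. Put $c_n(v)=\int_0^1e_n(x)v(x)\,dx$. The Cole-Hopf transform is $$H(u)(x)=\frac{e^{-\frac12\int_0^xu(s)ds}}{\int_0^1e^{-\frac12\int_0^yu(s)ds}dy},\qquad u\in L^2([0,1]).$$ *)

(* Defs.v *)
From HB Require Import structures.
From mathcomp Require Import all_boot all_order all_algebra.
From mathcomp Require Import all_classical all_reals all_analysis.

Set Implicit Arguments.
Unset Strict Implicit.
Unset Printing Implicit Defensive.

Import Order.TTheory GRing.Theory Num.Theory.
Import numFieldNormedType.Exports.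

Local Open Scope classical_set_scope.
Local Open Scope ring_scope.

(* Lebesgue measure carried by [0, 1], on the whole line *)
Definition leb01 (R : realType) :=
  mrestr (@lebesgue_measure R) (@measurable_itv R `[0, 1]).

HB.instance Definition _ (R : realType) := Measure.on (@leb01 R).

(* classes modulo equality leb01-almost everywhere, so that the values of a
   representative outside of [0, 1] are irrelevant *)
Definition L2 (R : realType) : Type := LspaceType2 (@leb01 R).

Section L2_metric.
Variable R : realType.

(* a representative of the class *)
Definition L2_fun (f : L2 R) : R -> R :=
  (f : {mfun_ (@leb01 R), _ >-> measurableTypeR R}).

Lemma L2_fun_Lfun (f : L2 R) : L2_fun f \in Lfun (@leb01 R) 2%:E.
Proof.
apply/andP; split; rewrite inE.
  exact: (@measurable_funPT _ _ _ _
    (repr (f : {mfun_ (@leb01 R), _ >-> measurableTypeR R}))).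
exact: (Lebesgue_finite (s := f)).
Qed.

Definition L2_Lfun (f : L2 R) : LfunType (@leb01 R) (lee1n 2) :=
  Lfun_Sub (lee1n 2) (L2_fun_Lfun f).

Definition L2_dist (f g : L2 R) : R :=
  fine 'N[@leb01 R]_2%:E[EFin \o (L2_fun f \- L2_fun g)%R]%E.

Lemma L2_distE f g :
  L2_dist f g = fine 'N[@leb01 R]_2%:E[EFin \o (L2_Lfun f - L2_Lfun g)%R]%E.
Proof. by []. Qed.

Lemma L2_distxx f : L2_dist f f = 0.
Proof.
rewrite /L2_dist (_ : _ \o _ = cst 0%E) ?Lnorm0 ?gt_eqF ?lte_fin//.
by apply/funext => x /=; rewrite subrr.
Qed.

Lemma L2_ae_eq (f g : L2 R) : L2_fun f = L2_fun g %[ae @leb01 R] -> f = g.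
Proof.
case: f g => [f [[ff]]] [g [[gf]]].
rewrite /L2_fun/= => fg.
have efg : f = g.
  rewrite -[f]reprK -[g]reprK.
  exact/eqP/ae_eqP.
subst g.
by rewrite (Prop_irrelevance ff gf).
Qed.

Lemma L2_dist_eq0 f g : L2_dist f g = 0 -> f = g.
Proof.
rewrite L2_distE => /fine_Lnormr_eq0 h; apply: L2_ae_eq.
move: h; apply: filterS => x /= h xT; have := h xT.
by move/eqP; rewrite subr_eq0 => /eqP.
Qed.

Lemma L2_dist_sym f g : L2_dist f g = L2_dist g f.
Proof.
rewrite L2_distE -LnormrN L2_distE; congr (fine (Lnorm _ _ (_ \o _))).
by apply/funext => x /=; rewrite opprB.
Qed.

Lemma L2_dist_triangle g f h : L2_dist f h <= L2_dist f g + L2_dist g h.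
Proof.
rewrite !L2_distE.
apply: le_trans (ler_LnormD _ _); rewrite le_eqVlt; apply/orP; left; apply/eqP.
congr (fine (Lnorm _ _ (_ \o _))).
by apply/funext => x /=; rewrite addrA subrK.
Qed.

HB.instance Definition _ := gen_eqMixin (L2 R).
HB.instance Definition _ := gen_choiceMixin (L2 R).
HB.instance Definition _ :=
  @isMetric.Build R (L2 R) L2_dist L2_distxx L2_dist_eq0 L2_dist_sym
    L2_dist_triangle.

End L2_metric.

Section calculus01.
Variable R : realType.
Implicit Types (f : R -> R) (x : R).

(* derivatives relative to [0, 1]: two-sided in the interior, one-sided at the
   endpoints; they only depend on the values of f on [0, 1]. *)
Definition diff_quot f x : R -> R := fun y => (f y - f x) / (y - x).

Definition derivable01 f x : Prop :=
  cvg (diff_quot f x @ within `[0, 1]%classic x^').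

Definition deriv01 f x : R :=
  lim (diff_quot f x @ within `[0, 1]%classic x^').

Definition smooth01 f : Prop :=
  forall (k : nat) (x : R), x \in `[0, 1] -> derivable01 (iter k deriv01 f) x.

Definition int01 f : R := \int[@lebesgue_measure R]_(x in `[0, 1]) f x.

End calculus01.

Section burgers.
Variables (R : realType) (V : R -> R).

Definition continuous_pos01 (g : R -> R -> R) : Prop :=
  {within `]0, +oo[%classic `*` `[0, 1]%classic,
    continuous (fun z : R * R => g z.1 z.2)}.

(* classical solution for t > 0: smooth in x, and u, its t-derivative and its
   first two x-derivatives are jointly continuous on ]0, +oo[ x [0, 1] *)
Definition burgers_classical (u : R -> R -> R) : Prop :=
  [/\ [/\ forall t : R, 0 < t -> smooth01 (u t) &
          forall t x : R, 0 < t -> x \in `[0, 1] -> derivable (u ^~ x) t 1],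
      [/\ continuous_pos01 u,
          continuous_pos01 (fun t x => derive1 (u ^~ x) t),
          continuous_pos01 (fun t => deriv01 (u t)) &
          continuous_pos01 (fun t => deriv01 (deriv01 (u t)))],
      forall t x : R, 0 < t -> x \in `[0, 1] ->
        derive1 (u ^~ x) t + u t x * deriv01 (u t) x
          = deriv01 (deriv01 (u t)) x + 2 * deriv01 V x &
      forall t : R, 0 < t -> u t 0 = 0 /\ u t 1 = 0].

Definition burgers_solution (u0 : L2 R) (w : R -> L2 R) : Prop :=
  [/\ w 0 = u0,
      {within `[0, +oo[%classic, continuous w} &
      exists2 u : R -> R -> R, burgers_classical u &
        forall t : R, 0 < t -> L2_fun (w t) = u t %[ae @leb01 R]].

(* Phi t is only constrained for 0 <= t *)
Definition burgers_flow (Phi : R -> L2 R -> L2 R) : Prop :=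
  forall u0, burgers_solution u0 (Phi ^~ u0).

End burgers.

Section koopman.
Variable R : realType.

Definition observables : set (L2 R -> R) := [set phi | continuous phi].

Definition koopman (Phi : R -> L2 R -> L2 R) (t : R) (phi : L2 R -> R) :
    L2 R -> R :=
  fun u0 => phi (Phi t u0).

Definition eigen_observable (K : (L2 R -> R) -> (L2 R -> R)) (a : R)
    (phi : L2 R -> R) : Prop :=
  [/\ observables phi, exists u, phi u != 0 & K phi = a \*o phi].

End koopman.

Section cole_hopf.
Variable R : realType.

Definition cole_hopf (u : L2 R) : R -> R :=
  let E y :=
    expR (- (2^-1 * \int[@lebesgue_measure R]_(s in `[0, y]) L2_fun u s)) in
  fun x => E x / int01 E.

Definition coef (e : nat -> R -> R) (n : nat) (v : R -> R) : R :=
  int01 (fun x => e n x * v x).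

(* the spectral decomposition of - d^2/dx^2 + V with Neumann conditions *)
Definition neumann_eigenbasis (V : R -> R) (mu : nat -> R) (e : nat -> R -> R)
    : Prop :=
  [/\ [/\ forall (n : nat) (x : R), x \in `[0, 1] -> derivable01 (e n) x,
          forall (n : nat) (x : R), x \in `[0, 1] -> derivable01 (deriv01 (e n)) x,
          forall (n : nat) (x : R), x \in `[0, 1] ->
            - deriv01 (deriv01 (e n)) x + V x * e n x = mu n * e n x &
          forall n, deriv01 (e n) 0 = 0 /\ deriv01 (e n) 1 = 0],
      forall i j, int01 (fun x => e i x * e j x) = (i == j)%:R,
      forall f : L2 R,
        (fun n => int01 (fun x =>
           (L2_fun f x - \sum_(i < n) coef e i (L2_fun f) * e i x) ^+ 2))
          @ \oo --> (0 : R),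
      0 < mu 0 < mu 1 /\ (forall n, (0 < n)%N -> mu n <= mu n.+1) &
      forall x : R, x \in `[0, 1] -> 0 < e 0 x].

Definition koopman_rate (mu : nat -> R) m (nu : m.+1.-tuple nat) : R :=
  \sum_(i < m.+1) (mu (tnth nu i) - mu 0).

Definition koopman_phi (e : nat -> R -> R) m (nu : m.+1.-tuple nat) :
    L2 R -> R :=
  fun u => \prod_(i < m.+1)
    (coef e (tnth nu i) (cole_hopf u) / coef e 0 (cole_hopf u)).

End cole_hopf.

(* Main.v *)
Require Import Defs.
From HB Require Import structures.
From mathcomp Require Import all_boot all_order all_algebra.
From mathcomp Require Import all_classical all_reals all_analysis.
From mathcomp Require Import measurable_realfun.
From mathcomp Require Import ring lra.

(* If u solves the Burgers equation, the unnormalised Cole-Hopf transform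
   E(t,x) = exp (- 1/2 \int_0^x u(t,s) ds) solves, for t > 0,
   E_t = E_xx - V E + (C(t) / 2) E with Neumann conditions, where
   C(t) = u_x(t,0) + 2 V(0).  Pairing with the Neumann eigenfunction e_n gives
   a_n' = (C(t) / 2 - mu_n) a_n for a_n = <e_n, E>, so that the unknown C
   drops out of a_n / a_0, which is the ratio of coefficients of H(u).  The
   value at t = 0 is reached because these ratios are continuous on L^2, and
   the product is not identically zero because H reaches, up to normalisation,
   every positive C^1 function, in particular e_0 + eps \sum_i e_(q_i). *)

Set Implicit Arguments.
Unset Strict Implicit.
Unset Printing Implicit Defensive.

Import Order.TTheory GRing.Theory Num.Theory.
Import numFieldNormedType.Exports.

Local Open Scope classical_set_scope.
Local Open Scope ring_scope.

(** * Calculus on the unit interval *)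

Section calculus01.
Variable R : realType.
Notation mu := (@lebesgue_measure R).
Implicit Types (f g F : R -> R) (x y : R).

Definition cont01 f := {within `[0, 1]%classic, continuous f}.

Lemma cont01_cst (c : R) : cont01 (fun=> c).
Proof. by move=> x; exact: cvg_cst. Qed.

Lemma cont01_opp f : cont01 f -> cont01 (fun x => - f x).
Proof. by move=> cf x; apply: cvgN; exact: cf. Qed.

Lemma cont01_add f g : cont01 f -> cont01 g -> cont01 (fun x => f x + g x).
Proof. by move=> cf cg x; apply: cvgD; [exact: cf|exact: cg]. Qed.

Lemma cont01_mul f g : cont01 f -> cont01 g -> cont01 (fun x => f x * g x).
Proof. by move=> cf cg x; apply: cvgM; [exact: cf|exact: cg]. Qed.

Lemma cont01_inv f :
  (forall x, x \in `[0, 1] -> f x != 0) -> cont01 f -> cont01 (fun x => (f x)^-1).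
Proof.
move=> f0 /subspace_continuousP cf; apply/subspace_continuousP => x x01.
by apply: cvgV; [exact: f0|exact: cf].
Qed.

Lemma cont01_comp g f : continuous g -> cont01 f -> cont01 (fun x => g (f x)).
Proof.
move=> cg /subspace_continuousP cf; apply/subspace_continuousP => x x01.
exact: (cvg_comp _ _ (cf x x01) (cg (f x))).
Qed.

Lemma cont01_sum n (f : 'I_n -> R -> R) :
  (forall i, cont01 (f i)) -> cont01 (fun x => \sum_i f i x).
Proof.
move=> cf; elim: n f cf => [|n ih] f cf.
  under [fun x => _]funext => x do rewrite big_ord0.
  exact: cont01_cst.
under [fun x => _]funext => x do rewrite big_ord_recl.
by apply: cont01_add; [exact: cf|exact: (ih (fun i => f (lift ord0 i)))].
Qed.

Lemma cont01W f y : y \in `[0, 1] -> cont01 f -> {within `[0, y], continuous f}.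
Proof.
rewrite in_itv/= => /andP[y0 y1]; apply: continuous_subspaceW.
by apply: subset_itvl; rewrite bnd_simp.
Qed.

Lemma cont01_integrable f y : y \in `[0, 1] -> cont01 f ->
  mu.-integrable `[0, y] (EFin \o f).
Proof.
move=> y01 cf; apply: continuous_compact_integrable; first exact: segment_compact.
exact: cont01W.
Qed.

Lemma cont01_bounded f : cont01 f ->
  exists2 M, 0 <= M & forall x, x \in `[0, 1] -> `|f x| <= M.
Proof.
move=> cf; have cf' : cont01 (fun x => `|f x|).
  by apply: (@cont01_comp Num.norm) => //; exact: norm_continuous.
have [c _ fc] := EVT_max ler01 cf'.
by exists `|f c|.
Qed.

(** Around an interior point, small translates [h + x] stay in [0, 1], so the translation carries
    [0^'] into the relative punctured filter at [x]. *)
Lemma derivable01_is_derive f x : x \in `]0, 1[ -> derivable01 f x ->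
  is_derive x 1 f (deriv01 f x).
Proof.
move=> x01 df.
have shx : h + x @[h --> 0^'] --> within `[0, 1]%classic x^'.
  move=> A; rewrite /within/= => -[e e0 eA].
  have /= [d d0 dI] := near_in_itvoo x01.
  exists (Num.min e d); first by rewrite /= lt_min e0.
  move=> h /=; rewrite sub0r normrN lt_min => /andP[he hd] h0.
  apply: eA => //=.
  - by rewrite opprD addrCA subrr addr0 normrN.
  - by rewrite -subr_eq0 addrK.
  - apply: subset_itv_oo_cc; apply: dI => /=.
    by rewrite opprD addrCA subrr addr0 normrN.
have := cvg_comp _ _ shx df.
have -> : diff_quot f x \o +%R^~ x =
    (fun h => h^-1 *: ((f \o shift x) (h *: (1 : R)) - f x)).
  apply/funext => h; rewrite /diff_quot/= addrK mulrC.
  by congr (_ *: (f (_ + _) - _)); rewrite scaler1.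
move=> cf; apply: DeriveDef; first by apply/cvg_ex; exists (deriv01 f x).
exact: cvg_lim cf.
Qed.

Lemma derivable01_cont f :
  (forall x, x \in `[0, 1] -> derivable01 f x) -> cont01 f.
Proof.
move=> df; apply/subspace_continuousP => x x01.
have dfx := df x x01.
have cf : f y @[y --> within `[0, 1]%classic x^'] --> f x.
  have -> : f x = f x + deriv01 f x * (x - x) by rewrite subrr mulr0 addr0.
  apply: (@cvg_trans _ ((f x + diff_quot f x y * (y - x)) @[y --> within `[0, 1]%classic x^'])).
    apply: near_eq_cvg; rewrite near_withinE.
    apply: filterS (nbhs_dnbhs_neq x) => y yx _.
    by rewrite /diff_quot mulfVK ?subr_eq0// addrC subrK.
  apply: cvgD; first exact: cvg_cst.
  apply: cvgM; first exact: dfx.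
  apply: cvgB; last exact: cvg_cst.
  move=> A xA; exact: (@cvg_within _ x^' _ `[0, 1]%classic A (nbhs_dnbhs xA)).
(* The limit so far is along punctured neighbourhoods; the point [y = x] is added by hand. *)
have := cf; rewrite !cvgrPdist_lt => h e e0.
have := h _ e0; rewrite !near_withinE => he.
have : \forall y \near x, y != x -> `[0, 1]%classic y -> `|f x - f y| < e.
  by apply: filterS he => y he yx y01; exact: he.
apply: filterS => y.
have [->|yx] := eqVneq y x; first by rewrite subrr normr0.
by apply.
Qed.

End calculus01.

(** * Fundamental theorem of calculus on [0, 1] *)

Section primitive01.
Variable R : realType.
Notation mu := (@lebesgue_measure R).
Implicit Types (f g F : R -> R) (x y : R).

Lemma cont01_at f x : x \in `]0, 1[ -> cont01 f -> {for x, continuous f}.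
Proof. by move=> x01 /(continuous_within_itvP _ ltr01)[+ _ _]; exact. Qed.

(** Two-sided derivatives are asked for only inside ]0, 1[, because differentiability relative to
    [0, 1] need not provide them at the endpoints; continuity of [F] takes over there. *)
Lemma FTC01 f F y : y \in `[0, 1] -> cont01 f -> cont01 F ->
    (forall x, x \in `]0, 1[ -> is_derive x 1 F (f x)) ->
  \int[mu]_(x in `[0, y]) f x = F y - F 0.
Proof.
move=> y01 cf cF dF; move: (y01); rewrite in_itv/= => /andP[+ y1].
rewrite le_eqVlt => /predU1P[<-|y0].
  by rewrite set_itv1 Rintegral_set1 subrr.
have sub x : x \in `]0, y[ -> x \in `]0, 1[.
  by rewrite !in_itv/= => /andP[-> /lt_le_trans]; exact.
rewrite /Rintegral (@continuous_FTC2 _ f F)//.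
- exact: cont01W.
- have /(continuous_within_itvP _ y0)[_ cF0 cFy] := @cont01W _ _ _ y01 cF.
  by split => // x /sub /dF[].
- by move=> x /sub /dF dFx; rewrite derive1E; exact: derive_val.
Qed.

Lemma cont01_primitive f : cont01 f ->
  cont01 (fun x => \int[mu]_(s in `[0, x]) f s).
Proof.
move=> cf; apply: parameterized_integral_continuous; first exact: ler01.
by apply: cont01_integrable => //; rewrite in_itv/= lexx ler01.
Qed.

Lemma is_derive_primitive01 f x : x \in `]0, 1[ -> cont01 f ->
  is_derive x 1 (fun y => \int[mu]_(s in `[0, y]) f s) (f x).
Proof.
move=> x01 cf; move: (x01); rewrite in_itv/= => /andP[x0 x1].
have i1 : mu.-integrable `[0, 1] (EFin \o f).
  by apply: cont01_integrable => //; rewrite in_itv/= lexx ler01.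
have [dF F'] := @continuous_FTC1_closed R f 0 x 1 x1 i1 x0 (@cont01_at _ _ x01 cf).
apply: DeriveDef; first exact: dF.
by rewrite -derive1E; exact: F'.
Qed.

Lemma Rintegral01_cst y c : y \in `[0, 1] ->
  \int[mu]_(s in `[0, y]) c = c * y.
Proof.
rewrite in_itv/= => /andP[+ _]; rewrite le_eqVlt => /predU1P[<-|y0].
  by rewrite set_itv1 Rintegral_set1 mulr0.
rewrite Rintegral_cst//= lebesgue_measure_itv/= lte_fin y0 oppr0.
by rewrite adde0.
Qed.

Lemma normr_Rintegral01_le f y M : y \in `[0, 1] -> cont01 f -> 0 <= M ->
  (forall x, x \in `[0, 1] -> `|f x| <= M) ->
  `|\int[mu]_(s in `[0, y]) f s| <= M.
Proof.
move=> y01 cf M0 fM.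
apply: (le_trans (le_normr_Rintegral _ _)) => //; first exact: cont01_integrable.
have cn : cont01 (fun x => `|f x|).
  by apply: (@cont01_comp _ Num.norm) => //; exact: norm_continuous.
apply: (@le_trans _ _ (\int[mu]_(s in `[0, y]) M)).
  apply: le_Rintegral => //; first exact: cont01_integrable.
    by apply: cont01_integrable => //; exact: cont01_cst.
  move=> x /= xy; apply: fM; move: xy y01; rewrite !in_itv/=.
  by move=> /andP[-> /le_trans xy] /andP[_ /xy].
rewrite Rintegral01_cst//; move: y01; rewrite in_itv/= => /andP[y0 y1].
by rewrite ler_piMr.
Qed.

End primitive01.

(** * Differentiation under the integral sign in the time variable *)

Section param.
Variable R : realType.
Notation mu := (@lebesgue_measure R).
Implicit Types (f : R -> R -> R) (t x y : R).

(** Bounds local in time and away from t = 0, where the initial datum is only square-integrable;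
    this is the domination used to differentiate integrals over space. *)
Definition loc_bounded01 f := forall a b, 0 < a -> exists2 M, 0 <= M &
  forall t x, t \in `[a, b] -> x \in `[0, 1] -> `|f t x| <= M.

Lemma continuous_pos01_bounded f : continuous_pos01 f -> loc_bounded01 f.
Proof.
move=> cf a b a0.
pose K : set (R * R) := `[a, b]%classic `*` `[0, 1]%classic.
have cK : compact K by apply: compact_setX; exact: segment_compact.
have cf' : {within K, continuous (fun z : R * R => f z.1 z.2)}.
  apply: continuous_subspaceW cf => -[t x] [/= tab x01]; split => //=.
  move: tab; rewrite !in_itv/= => /andP[/(lt_le_trans a0) ta _].
  by rewrite ta.
have /compact_bounded[M [_ HM]] := continuous_compact cf' cK.
(* Compactness gives a bound by each number strictly above [M]; this one is also nonnegative. *)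
exists (`|M| + 1) => [|t x tab x01]; first exact: addr_ge0.
apply: (HM (`|M| + 1)); first by rewrite (le_lt_trans (ler_norm M))// ltrDl.
by exists (t, x) => //; split.
Qed.

Lemma continuous_pos01_cont01 f t : 0 < t -> continuous_pos01 f -> cont01 (f t).
Proof.
move=> t0 /subspace_continuousP cf; apply/subspace_continuousP => x x01.
have tx : (`]0, +oo[%classic `*` `[0, 1]%classic) (t, x).
  by split; rewrite /= ?in_itv/= ?t0 ?andbT.
apply: (cvg_comp (fun y : R => (t, y)) _ _ (cf _ tx)) => /=.
move=> A [[B C]] /= [[e e0 eB] Cx] BCA.
rewrite /= /within/=; apply: filterS Cx => y Cy y01.
apply: (BCA (t, y)); last by split; rewrite /= ?in_itv/= ?t0 ?andbT.
by split => //=; apply: eB => /=; rewrite subrr normr0.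
Qed.

(** Dominated differentiation on the window ]t / 2, 2 t[, which contains [t] and stays away from 0,
    so that a constant dominates the time derivative. *)
Lemma is_derive_Rintegral01 f y t : y \in `[0, 1] -> 0 < t ->
    (forall t, 0 < t -> cont01 (f t)) ->
    (forall t x, 0 < t -> x \in `[0, 1] -> derivable (f ^~ x) t 1) ->
    loc_bounded01 (fun t x => derive1 (f ^~ x) t) ->
  is_derive t 1 (fun t => \int[mu]_(s in `[0, y]) f t s)
    (\int[mu]_(s in `[0, y]) derive1 (f ^~ s) t).
Proof.
move=> y01 t0 cf df bf.
have [M M0 HM] := bf (t / 2) (2 * t) (divr_gt0 t0 (ltr0Sn _ _)).
have It : `]t / 2, 2 * t[%classic t.
  by rewrite /= in_itv/=; apply/andP; split; lra.
have sub x : `[0, y]%classic x -> x \in `[0, 1].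
  by move: y01; rewrite /= !in_itv/= => /andP[_ y1] /andP[-> /le_trans]; exact.
have pos x : `]t / 2, 2 * t[%classic x -> 0 < x.
  by rewrite /= in_itv/= => /andP[+ _]; apply: lt_trans; rewrite divr_gt0.
have h1 x : `]t / 2, 2 * t[%classic x -> mu.-integrable `[0, y] (EFin \o f x).
  by move=> /pos x0; apply: cont01_integrable => //; exact: cf.
have h2 x s : `]t / 2, 2 * t[%classic x -> `[0, y]%classic s ->
    derivable (f ^~ s) x 1.
  by move=> /pos x0 /sub s01; exact: df.
have h3 : mu.-integrable `[0, y] (EFin \o (fun=> M)).
  by apply: cont01_integrable => //; exact: cont01_cst.
have h4 x s : `]t / 2, 2 * t[%classic x -> `[0, y]%classic s ->
    `|partial1of2 f x s| <= M.
  by move=> xI /sub s01; apply: HM => //; exact: subset_itv_oo_cc.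
apply: DeriveDef.
  exact: (derivable_under_integral _ It h1 h2 (fun=> M0) h3 h4).
rewrite -derive1E.
exact: (differentiation_under_integral _ It h1 h2 (fun=> M0) h3 h4).
Qed.

End param.

(** * Primitives of square-integrable functions and the Cole-Hopf transform *)

Section L2_integral.
Variable R : realType.
Notation mu := (@lebesgue_measure R).
Implicit Types (u v : L2 R) (x y : R).

(** Both measures agree on subsets of [0, 1]. This links norms and classes, taken for [leb01], to
    the integrals of the Cole-Hopf transform, taken for Lebesgue measure. *)
Lemma integral_leb01 y (f : R -> \bar R) : y \in `[0, 1] ->
  (\int[mu]_(x in `[0%R, y]) f x = \int[@leb01 R]_(x in `[0%R, y]) f x)%E.
Proof.
move=> y01; apply: eq_measure_integral => A mA A0y.
rewrite [RHS](_ : _ = mu (A `&` `[0, 1]))//; congr mu; apply/esym/setIidl.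
apply: subset_trans A0y _; apply: subset_itvl; rewrite bnd_simp.
by move: y01; rewrite in_itv/= => /andP[].
Qed.

Lemma leb01_setT : leb01 (R := R) [set: R] = 1%E.
Proof.
rewrite [LHS](_ : _ = mu (setT `&` `[0, 1]))// setTI.
by rewrite lebesgue_measure_itv/= lte_fin ltr01 oppr0 adde0.
Qed.

(** Hölder's inequality against the constant 1, whose norm is 1 for a probability measure. *)
Lemma L1_le_L2 d (T : measurableType d) (P : {measure set T -> \bar R})
    (g : T -> R) : P setT = 1%E -> g \in Lfun P 2%:E ->
  P.-integrable setT (EFin \o g) /\
  (\int[P]_x `|(g x)%:E| <= 'N[P]_2%:E[EFin \o g])%E.
Proof.
move=> P1 g2; split.
  by apply/Lfun1_integrable; apply: Lfun_subset12 g2; rewrite P1.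
move: g2 => /andP[]; rewrite !inE/= => mg _.
have := @hoelder _ _ _ P g (cst 1) 2 2 mg (measurable_cst _).
rewrite Lnorm1 Lnorm_cst1 P1 poweR1r mule1.
under eq_integral do rewrite /= mulr1.
by apply => //; rewrite [RHS]splitr !div1r.
Qed.

Lemma Rintegral01_le_Lnorm2 (g : R -> R) y : y \in `[0, 1] ->
    g \in Lfun (@leb01 R) 2%:E ->
  mu.-integrable `[0, y] (EFin \o g) /\
  (`|\int[mu]_(x in `[0, y]) g x|%:E <= 'N[@leb01 R]_2%:E[EFin \o g])%E.
Proof.
move=> y01 g2; have [ig ng] := L1_le_L2 leb01_setT g2.
have igy : (@leb01 R).-integrable `[0, y] (EFin \o g) by exact: integrableS ig.
have iy : mu.-integrable `[0, y] (EFin \o g).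
  by move/integrableP : igy => [mg fg]; apply/integrableP; rewrite integral_leb01.
split => //; apply: le_trans ng; rewrite EFin_normr_Rintegral//.
apply: (@le_trans _ _ (\int[mu]_(x in `[0%R, y]) `|(g x)%:E|)%E).
  by apply: le_abse_integral => //; have /integrableP[] := iy.
rewrite integral_leb01//; apply: ge0_subset_integral => //.
by have /integrable_abse/integrableP[] := ig.
Qed.

Lemma L2_integrable u y : y \in `[0, 1] ->
  mu.-integrable `[0, y] (EFin \o L2_fun u).
Proof. by move=> y01; have [] := Rintegral01_le_Lnorm2 y01 (L2_fun_Lfun u). Qed.

(** The estimate is uniform in [y]: taking primitives is 1-Lipschitz from L^2 to the sup norm, which
    is the source of the continuity of the observables. *)
Lemma L2_Rintegral_dist u v y : y \in `[0, 1] ->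
  `|\int[mu]_(x in `[0, y]) L2_fun u x - \int[mu]_(x in `[0, y]) L2_fun v x|
    <= L2_dist u v.
Proof.
move=> y01.
rewrite -RintegralB//; [|exact: L2_integrable..].
have [_ h] := Rintegral01_le_Lnorm2 y01 (LfunP (L2_Lfun u - L2_Lfun v)).
by rewrite -lee_fin L2_distE finite_norm_fine.
Qed.

Lemma L2_Rintegral_ae u (g : R -> R) y : y \in `[0, 1] -> cont01 g ->
    L2_fun u = g %[ae @leb01 R] ->
  \int[mu]_(x in `[0, y]) L2_fun u x = \int[mu]_(x in `[0, y]) g x.
Proof.
move=> y01 cg ug; rewrite /Rintegral !integral_leb01//; congr fine.
apply: ae_eq_integral => //.
- by have /integrableP[] := L2_integrable u y01.
- by have /integrableP[] := cont01_integrable y01 cg.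
- apply: (@filterS _ _ (ae_filter_ringOfSetsType (@leb01 R)) _ _ _ ug).
  by move=> x /= ugx _; rewrite ugx.
Qed.

Lemma L2_primitive_cont01 u : cont01 (fun x => \int[mu]_(s in `[0, x]) L2_fun u s).
Proof.
apply: parameterized_integral_continuous; first exact: ler01.
by apply: L2_integrable; rewrite in_itv/= lexx ler01.
Qed.

End L2_integral.

(** * Continuity on L^2 of the Cole-Hopf coefficients and of their ratios *)

Section cole_hopf01.
Variable R : realType.
Notation mu := (@lebesgue_measure R).
Implicit Types (u v : L2 R) (x y : R) (e : nat -> R -> R).

(** The numerator of [cole_hopf]; the normalising integral cancels in every ratio of
    coefficients. *)
Definition chopf u y : R :=
  expR (- (2^-1 * \int[mu]_(s in `[0, y]) L2_fun u s)).

Lemma chopf_cont01 u : cont01 (chopf u).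
Proof.
apply: (@cont01_comp _ expR); first exact: continuous_expR.
apply: cont01_opp; apply: cont01_mul; first exact: cont01_cst.
exact: L2_primitive_cont01.
Qed.

Lemma int01_gt0 (f : R -> R) : cont01 f ->
  (forall x, x \in `[0, 1] -> 0 < f x) -> 0 < int01 f.
Proof.
move=> cf f0; have [c c01 fc] := EVT_min ler01 cf.
have h1 : 1 \in `[0, 1 : R] by rewrite in_itv/= ler01 lexx.
apply: (lt_le_trans (f0 c c01)).
have -> : f c = \int[mu]_(s in `[0, 1]) f c by rewrite Rintegral01_cst// mulr1.
apply: le_Rintegral => //.
- by apply: cont01_integrable => //; exact: cont01_cst.
- exact: cont01_integrable.
Qed.

Lemma coef_chopf_gt0 e u n : cont01 (e n) ->
  (forall x, x \in `[0, 1] -> 0 < e n x) -> 0 < coef e n (chopf u).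
Proof.
move=> ce e0; apply: int01_gt0.
  by apply: cont01_mul => //; exact: chopf_cont01.
by move=> x x01; rewrite mulr_gt0 ?expR_gt0// e0.
Qed.

Lemma coef_cole_hopf e u n : cont01 (e n) ->
  coef e n (cole_hopf u) = coef e n (chopf u) / int01 (chopf u).
Proof.
move=> ce; rewrite /coef /int01 -RintegralZr//.
  by apply: eq_Rintegral => x _; rewrite /cole_hopf mulrA.
have h1 : 1 \in `[0, 1 : R] by rewrite in_itv/= ler01 lexx.
apply: cont01_integrable => //.
by apply: cont01_mul => //; exact: chopf_cont01.
Qed.

Lemma koopman_phiE e m (nu : m.+1.-tuple nat) u : (forall n, cont01 (e n)) ->
  koopman_phi e nu u =
  \prod_(i < m.+1) (coef e (tnth nu i) (chopf u) / coef e 0 (chopf u)).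
Proof.
move=> ce; apply: eq_bigr => i _; rewrite !coef_cole_hopf//.
have ne0 : int01 (chopf u) != 0.
  rewrite gt_eqF// int01_gt0//; first exact: chopf_cont01.
  by move=> x _; exact: expR_gt0.
by rewrite -mulf_div divff ?mulr1// invr_eq0.
Qed.

Lemma normr_expR_sub1 x : `|expR x - 1| <= expR `|x| - 1.
Proof.
have [x0|x0] := leP 0 x.
  by rewrite (ger0_norm x0) ger0_norm// subr_ge0 -[leLHS]expR0 ler_expR.
(* For negative [x] the claim is a + b >= 2 with a = [expR x] and b = [expR (- x)], which follows
   from a b = 1 and positivity. *)
have h : expR x * expR (- x) = 1 by rewrite -expRD subrr expR0.
have h1 : expR x < 1 by rewrite expR_lt1.
have h0 : 0 < expR x by exact: expR_gt0.
rewrite ltr0_norm ?subr_lt0// ?ltr0_norm//.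
by nra.
Qed.

(** The quotient [chopf v / chopf u] is the exponential of half the difference of the primitives of
    [u] and [v], which is at most the distance of [u] and [v]. Factoring out [chopf u] gives a
    modulus that depends on [u] only through its bound [M]. *)
Lemma coef_chopf_continuous e n : cont01 (e n) ->
  continuous (fun u : L2 R => coef e n (chopf u)).
Proof.
move=> ce u.
have h1 : 1 \in `[0, 1 : R] by rewrite in_itv/= ler01 lexx.
have [B B0 HB] := cont01_bounded ce.
have [M M0 HM] := cont01_bounded (@chopf_cont01 u).
have bound v : `|coef e n (chopf u) - coef e n (chopf v)| <=
    B * M * (expR (2^-1 * mdist u v) - 1).
  rewrite /coef /int01 -RintegralB//; last 2 first.
    by apply: cont01_integrable => //; apply: cont01_mul => //; exact: chopf_cont01.
    by apply: cont01_integrable => //; apply: cont01_mul => //; exact: chopf_cont01.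
  apply: normr_Rintegral01_le => //.
  - apply: cont01_add; last apply: cont01_opp;
      apply: cont01_mul => //; exact: chopf_cont01.
  - rewrite !mulr_ge0// subr_ge0 -[leLHS]expR0 ler_expR mulr_ge0//; exact: mdist_ge0.
  - move=> x x01.
    have -> : e n x * chopf u x - e n x * chopf v x =
       e n x * chopf u x * (1 - expR (2^-1 *
         (\int[mu]_(s in `[0, x]) L2_fun u s - \int[mu]_(s in `[0, x]) L2_fun v s))).
      rewrite mulrBr mulr1; congr (_ - _).
      rewrite -mulrA /chopf -expRD; congr (_ * expR _); ring.
    rewrite !normrM; apply: ler_pM => //.
      by apply: ler_pM => //; [exact: HB|exact: HM].
    rewrite distrC; apply: (le_trans (normr_expR_sub1 _)).
    rewrite lerD2r ler_expR normrM ger0_norm// ler_pM2l//.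
    exact: L2_Rintegral_dist.
apply/(@cvgrPdist_le _ _ _ _ (nbhs_filter u)) => eps eps0.
have cexp : B * M * (expR (2^-1 * d) - 1) @[d --> (0 : R)] --> B * M * (expR (2^-1 * 0) - 1).
  apply: cvgM; first exact: cvg_cst.
  apply: cvgB; last exact: cvg_cst.
  apply: continuous_cvg; first exact: continuous_expR.
  by apply: cvgM; [exact: cvg_cst|exact: cvg_id].
rewrite mulr0 expR0 subrr mulr0 in cexp.
move/cvgrPdist_le : cexp => /(_ _ eps0) [d /= d0 Hd].
rewrite /prop_near1 -metricType_numDomainType.filter_from_mdist_nbhs; exists d => // v /= uv.
apply: (le_trans (bound v)).
have := Hd (mdist u v); rewrite /= !sub0r !normrN.
rewrite ger0_norm; last exact: mdist_ge0.
by move=> /(_ uv); apply: le_trans; exact: ler_norm.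
Qed.

Lemma continuous_prod (T : topologicalType) n (f : 'I_n -> T -> R) :
  (forall i, continuous (f i)) -> continuous (fun z => \prod_i f i z).
Proof.
by move=> cf z; apply: cvg_big => [|i _]; [exact: mul_continuous|exact: cf].
Qed.

Lemma continuous_div (T : topologicalType) (f g : T -> R) :
  (forall z, g z != 0) -> continuous f -> continuous g ->
  continuous (fun z => f z / g z).
Proof.
move=> g0 cf cg z; apply: cvgM; first exact: cf.
by apply: cvgV; [exact: g0|exact: cg].
Qed.

Lemma koopman_phi_continuous e m (nu : m.+1.-tuple nat) :
    (forall n, cont01 (e n)) -> (forall x, x \in `[0, 1] -> 0 < e 0 x) ->
  continuous (koopman_phi e nu).
Proof.
move=> ce e0.
rewrite (_ : koopman_phi e nu = fun u => \prod_(i < m.+1)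
    (coef e (tnth nu i) (chopf u) / coef e 0 (chopf u))); last first.
  by apply/funext => u; exact: koopman_phiE.
apply: continuous_prod => i; apply: continuous_div.
- by move=> u; rewrite gt_eqF// coef_chopf_gt0.
- exact: coef_chopf_continuous.
- exact: coef_chopf_continuous.
Qed.

End cole_hopf01.

(** * The equation satisfied by the Cole-Hopf coefficients along the flow *)

Section dynamics.
Variable R : realType.
Notation mu := (@lebesgue_measure R).
Variables (V : R -> R) (u : R -> R -> R).
Hypotheses (V_smooth : smooth01 V) (u_sol : burgers_classical V u).
Implicit Types (t x y : R).

Let one01 : 1 \in `[0, 1 : R]. Proof. by rewrite in_itv/= lexx ler01. Qed.

Let u_d1 t x : 0 < t -> x \in `[0, 1] -> derivable01 (u t) x.
Proof. by case: u_sol => -[su _] _ _ _ /su /(_ 0%N x). Qed.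

Let u_d2 t x : 0 < t -> x \in `[0, 1] -> derivable01 (deriv01 (u t)) x.
Proof. by case: u_sol => -[su _] _ _ _ /su /(_ 1%N x). Qed.

Let u_cont t : 0 < t -> cont01 (u t).
Proof. by move=> t0; apply: derivable01_cont => x; exact: u_d1. Qed.

Let ux_cont t : 0 < t -> cont01 (deriv01 (u t)).
Proof. by move=> t0; apply: derivable01_cont => x; exact: u_d2. Qed.

Let V_d1 x : x \in `[0, 1] -> derivable01 V x.
Proof. exact: (@V_smooth 0%N x). Qed.

Let V_cont : cont01 V.
Proof. exact: derivable01_cont. Qed.

Let ut t x := derive1 (u ^~ x) t.

Let ut_cont t : 0 < t -> cont01 (ut t).
Proof.
by move=> t0; case: u_sol => _ [_ + _ _] _ _; exact: continuous_pos01_cont01.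
Qed.

(** In conservation form the Burgers equation says that u_t is the x-derivative of this flux. At x =
    0, where u vanishes, the flux is C(t). *)
Let flux t x := deriv01 (u t) x - 2^-1 * (u t x * u t x) + 2 * V x.

Let flux_cont t : 0 < t -> cont01 (flux t).
Proof.
move=> t0; apply: cont01_add; first apply: cont01_add; first exact: ux_cont.
- apply/cont01_opp/cont01_mul; first exact: cont01_cst.
  by apply: cont01_mul; exact: u_cont.
- by apply: cont01_mul; [exact: cont01_cst|exact: V_cont].
Qed.

Lemma Rintegral_ut t y : 0 < t -> y \in `[0, 1] ->
  \int[mu]_(x in `[0, y]) ut t x = flux t y - flux t 0.
Proof.
move=> t0 y01; apply: FTC01 => //; [exact: ut_cont|exact: flux_cont|].
move=> x x01; have x01' : x \in `[0, 1] by exact: subset_itv_oo_cc.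
have dV := derivable01_is_derive x01 (V_d1 x01').
have du := derivable01_is_derive x01 (u_d1 t0 x01').
have dux := derivable01_is_derive x01 (u_d2 t0 x01').
case: u_sol => _ _ /(_ t x t0 x01') pde _.
have {}pde : ut t x = deriv01 (deriv01 (u t)) x + 2 * deriv01 V x
    - u t x * deriv01 (u t) x by rewrite -pde addrK.
rewrite pde; apply: is_derive_eq.
rewrite /GRing.scale/=; lra.
Qed.

(** Built from the classical representative instead of the L^2 class, so that it can be
    differentiated pointwise in t and x. *)
Definition chopf_sol t x := expR (- (2^-1 * \int[mu]_(s in `[0, x]) u t s)).

Lemma chopf_sol_cont01 t : 0 < t -> cont01 (chopf_sol t).
Proof.
move=> t0; apply: (@cont01_comp _ expR); first exact: continuous_expR.
apply: cont01_opp; apply: cont01_mul; first exact: cont01_cst.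
by apply: cont01_primitive; exact: u_cont.
Qed.

Lemma is_derive_chopf_sol_t t y : 0 < t -> y \in `[0, 1] ->
  is_derive t 1 (chopf_sol ^~ y)
    (- (2^-1 * \int[mu]_(x in `[0, y]) ut t x) * chopf_sol t y).
Proof.
move=> t0 y01.
have [[_ ud] [_ utc _ _] _ _] := u_sol.
have dU := is_derive_Rintegral01 y01 t0 u_cont ud (continuous_pos01_bounded utc).
rewrite /chopf_sol.
apply: is_derive_eq; rewrite /GRing.scale/=; lra.
Qed.

Lemma is_derive_chopf_sol_x t x : 0 < t -> x \in `]0, 1[ ->
  is_derive x 1 (chopf_sol t) (- (2^-1 * u t x) * chopf_sol t x).
Proof.
move=> t0 x01.
have dU := is_derive_primitive01 x01 (u_cont t0).
rewrite /chopf_sol.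
apply: is_derive_eq; rewrite /GRing.scale/=; lra.
Qed.

Lemma chopf_sol_bounded : loc_bounded01 chopf_sol.
Proof.
move=> a b a0; have [_ [uc _ _ _] _ _] := u_sol.
have [M M0 HM] := @continuous_pos01_bounded _ _ uc a b a0.
exists (expR (2^-1 * M)) => [|t x tab x01]; first exact: expR_ge0.
have t0 : 0 < t by move: tab; rewrite in_itv/= => /andP[/(lt_le_trans a0)].
rewrite ger0_norm ?expR_ge0// ler_expR -mulrN ler_pM2l//.
apply: (le_trans (ler_norm _)); rewrite normrN.
apply: normr_Rintegral01_le => //; first exact: u_cont.
by move=> s; exact: HM.
Qed.

Variables (g : R -> R) (m : R).
Hypothesis g_d1 : forall x, x \in `[0, 1] -> derivable01 g x.
Hypothesis g_d2 : forall x, x \in `[0, 1] -> derivable01 (deriv01 g) x.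
Hypothesis g_eigen : forall x, x \in `[0, 1] ->
  - deriv01 (deriv01 g) x + V x * g x = m * g x.
Hypothesis g_neumann : deriv01 g 0 = 0 /\ deriv01 g 1 = 0.

Let g_cont : cont01 g.
Proof. exact: derivable01_cont. Qed.

Let gx_cont : cont01 (deriv01 g).
Proof. exact: derivable01_cont. Qed.

(** Writing E for [chopf_sol], one has E_x = - u E / 2, so this is the boundary expression E_x g - E
    g' of Green's formula. *)
Let green t x := - (chopf_sol t x * (2^-1 * (u t x * g x) + deriv01 g x)).

Let density t x := g x * (- (2^-1 * \int[mu]_(s in `[0, x]) ut t s) * chopf_sol t x).

Let density_cont t : 0 < t -> cont01 (density t).
Proof.
move=> t0; apply: cont01_mul => //; apply: cont01_mul; last exact: chopf_sol_cont01.
apply/cont01_opp/cont01_mul; first exact: cont01_cst.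
by apply: cont01_primitive; exact: ut_cont.
Qed.

Lemma is_derive_weighted t y : 0 < t -> y \in `[0, 1] ->
  is_derive t 1 (fun t => g y * chopf_sol t y) (density t y).
Proof.
move=> t0 y01; have dE := is_derive_chopf_sol_t t0 y01.
by apply: is_derive_eq; rewrite /GRing.scale/= /density; lra.
Qed.

(* Green's identity: the boundary terms vanish because u, g' do at 0 and 1. *)
Lemma Rintegral_density t : 0 < t ->
  int01 (density t) =
  (2^-1 * flux t 0 - m) * int01 (fun x => g x * chopf_sol t x).
Proof.
move=> t0; rewrite /int01.
have [_ _ _ /(_ t t0) [ut0 ut1]] := u_sol.
have [g0 g1] := g_neumann.
have cE := chopf_sol_cont01 t0.
have cgE : cont01 (fun x => g x * chopf_sol t x) by exact: cont01_mul.
have cu := u_cont t0.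
have cux := ux_cont t0.
rewrite -RintegralZl//; last exact: cont01_integrable.
apply/eqP; rewrite -subr_eq0 -RintegralB//; last 2 first.
- by apply: cont01_integrable => //; exact: density_cont.
- by apply: cont01_integrable => //; apply: cont01_mul => //; exact: cont01_cst.
(* The integrand g E_t - (C / 2 - m) g E is exactly the x-derivative of [green t]: the two
   occurrences of C / 2 cancel and the eigenvalue equation replaces g''. *)
rewrite [X in X == 0](_ : _ = green t 1 - green t 0).
  by rewrite /green ut0 ut1 g0 g1 !mul0r mulr0 addr0 !mulr0 subrr.
apply: FTC01.
- exact: one01.
- apply: cont01_add; first exact: density_cont.
  by apply/cont01_opp/cont01_mul; [exact: cont01_cst|exact: cgE].
- apply/cont01_opp/cont01_mul; first exact: cE.
  apply: cont01_add; last exact: gx_cont.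
  by apply: cont01_mul; [exact: cont01_cst|exact: cont01_mul].
move=> x x01; have x01' : x \in `[0, 1] by exact: subset_itv_oo_cc.
have du := derivable01_is_derive x01 (u_d1 t0 x01').
have dg := derivable01_is_derive x01 (g_d1 x01').
have dgx := derivable01_is_derive x01 (g_d2 x01').
have dE := is_derive_chopf_sol_x t0 x01.
have gE : deriv01 (deriv01 g) x = V x * g x - m * g x.
  by rewrite -(g_eigen x01'); ring.
apply: is_derive_eq; rewrite /GRing.scale/= gE /density Rintegral_ut// /flux.
by field.
Qed.

Lemma is_derive_weighted_int t : 0 < t ->
  is_derive t 1 (fun t => int01 (fun x => g x * chopf_sol t x))
    ((2^-1 * flux t 0 - m) * int01 (fun x => g x * chopf_sol t x)).
Proof.
move=> t0; rewrite -Rintegral_density//.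
have E t' x : 0 < t' -> x \in `[0, 1] ->
    derive1 (fun t => g x * chopf_sol t x) t' = density t' x.
  move=> t'0 x01; rewrite derive1E; have := is_derive_weighted t'0 x01.
  by move=> h; exact: derive_val.
rewrite (_ : int01 (density t) =
    \int[mu]_(x in `[0, 1]) derive1 (fun t => g x * chopf_sol t x) t); last first.
  by apply: eq_Rintegral => x; rewrite inE => x01; rewrite E.
apply: (is_derive_Rintegral01 one01 t0).
- by move=> s s0; apply: cont01_mul => //; exact: chopf_sol_cont01.
- by move=> s x s0 x01; have [] := is_derive_weighted s0 x01.
(* Domination on [a, b]: the bounds [B] of g, [M] of u_t and [K] of E are multiplied. *)
- move=> a b a0.
  have [B B0 HB] := cont01_bounded g_cont.
  have [_ [_ utc _ _] _ _] := u_sol.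
  have [M M0 HM] := @continuous_pos01_bounded _ _ utc a b a0.
  have [K K0 HK] := @chopf_sol_bounded a b a0.
  exists (B * (2^-1 * M * K)) => [|s x sab x01].
    by rewrite !mulr_ge0.
  have s0 : 0 < s by move: sab; rewrite in_itv/= => /andP[/(lt_le_trans a0)].
  rewrite E// /density !(normrM, normrN).
  have abs3 p q r : 0 <= `|p : R| * `|q : R| * `|r : R| by rewrite !mulr_ge0.
  apply: ler_pM; [by []|exact: abs3|exact: HB|].
  apply: ler_pM; [by rewrite mulr_ge0|by []| |exact: HK].
    rewrite ger0_norm// ler_pM2l//.
    apply: (normr_Rintegral01_le x01 (ut_cont s0) M0).
    by move=> z; exact: HM.
Qed.

End dynamics.

(** * Evolution of the coefficient ratios along a Burgers trajectory *)

Section koopman_flow.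
Variable R : realType.
Notation mu := (@lebesgue_measure R).
Implicit Types (t : R) (n : nat).
Variables (V : R -> R) (V_smooth : smooth01 V).
Variables (lam : nat -> R) (e : nat -> R -> R).
Hypothesis eP : neumann_eigenbasis V lam e.

Lemma eigen_cont01 n : cont01 (e n).
Proof. by case: eP => -[d _ _ _] _ _ _ _; apply: derivable01_cont => x; exact: d. Qed.

Lemma eigen_deriv_cont01 n : cont01 (deriv01 (e n)).
Proof. by case: eP => -[_ d _ _] _ _ _ _; apply: derivable01_cont => x; exact: d. Qed.

Lemma eigen0_gt0 x : x \in `[0, 1] -> 0 < e 0 x.
Proof. by case: eP => _ _ _ _; exact. Qed.

Let rho n (u : L2 R) := coef e n (chopf u) / coef e 0 (chopf u).

Let coef0_gt0 u : 0 < coef e 0 (chopf u).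
Proof. by apply: coef_chopf_gt0; [exact: eigen_cont01|exact: eigen0_gt0]. Qed.

Let rho_continuous n : continuous (rho n).
Proof.
apply: continuous_div; first by move=> u; rewrite gt_eqF.
- exact/coef_chopf_continuous/eigen_cont01.
- exact/coef_chopf_continuous/eigen_cont01.
Qed.

Variables (u0 : L2 R) (w : R -> L2 R).
Hypothesis w_sol : burgers_solution V u0 w.

Let is_derive_rho n t : 0 < t ->
  is_derive t 1 (fun s => rho n (w s)) (- (lam n - lam 0) * rho n (w t)).
Proof.
move=> t0; case: w_sol => _ _ [u u_sol wu].
(* Integrals only see the almost everywhere class, so for positive times the class [w s] may be
   replaced by the classical solution. *)
have coefE k s : 0 < s ->
    coef e k (chopf (w s)) = int01 (fun x => e k x * chopf_sol u s x).
  move=> s0; apply: eq_Rintegral => x; rewrite inE => x01.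
  congr (_ * expR (- (_ * _))); apply: L2_Rintegral_ae => //; last exact: wu.
  case: u_sol => -[su _] _ _ _.
  by apply: derivable01_cont => y; exact: (@su s s0 0%N y).
(* The bracket is the flux at x = 0 unfolded; it is the same for every [k] and cancels in the
   quotient rule. *)
have dcoef k : is_derive t 1 (fun s => coef e k (chopf (w s)))
    ((2^-1 * (deriv01 (u t) 0 - 2^-1 * (u t 0 * u t 0) + 2 * V 0) - lam k)
     * coef e k (chopf (w t))).
  rewrite coefE//; case: eP => -[d1 d2 ee en] _ _ _ _.
  (* [coefE] holds only for positive times, hence the passage through equality near [t]. *)
  apply: near_eq_is_derive (is_derive_weighted_int V_smooth u_sol
    (d1 k) (d2 k) (ee k) (en k) t0).
  near=> s; rewrite coefE//; near: s; exact: lt_nbhsr.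
have c0 : coef e 0 (chopf (w t)) != 0 by rewrite gt_eqF.
have dn := dcoef n; have d0 := dcoef 0%N.
have dV := is_deriveV c0 d0.
rewrite /rho; apply: is_derive_eq.
by rewrite /GRing.scale/= /rho; field.
Unshelve. all: by end_near. Qed.

(** Multiplied by its integrating factor, the ratio has zero derivative on ]0, t[. Continuity of the
    trajectory in L^2 and of [rho n] extends constancy to time 0, where no differential equation is
    available. *)
Lemma koopman_ratio n t : 0 <= t ->
  rho n (w t) = expR (- ((lam n - lam 0) * t)) * rho n u0.
Proof.
rewrite le_eqVlt => /predU1P[<-|t0]; case: w_sol => w0 wc _.
  by rewrite w0 mulr0 oppr0 expR0 mul1r.
pose h s := expR ((lam n - lam 0) * s) * rho n (w s).
have dh s : s \in `]0, t[ -> is_derive s 1 h 0.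
  rewrite in_itv/= => /andP[s0 _]; have dr := is_derive_rho n s0.
  by rewrite /h; apply: is_derive_eq; rewrite /GRing.scale/=; ring.
have ch : {within `[0, t], continuous h}.
  apply/subspace_continuousP => s; rewrite /= in_itv/= => /andP[s0 st].
  apply: cvgM.
    apply: continuous_cvg; first exact: continuous_expR.
    apply: cvgM; first exact: cvg_cst.
    exact: cvg_within.
  have wst : {within `[0, t], continuous w}.
    by apply: continuous_subspaceW wc => r; rewrite /= !in_itv/= => /andP[->].
  move/subspace_continuousP : wst => /(_ s); rewrite /= in_itv/= s0 st => /(_ isT) ws.
  by apply: (cvg_comp w (rho n) ws); exact: rho_continuous.
have [c _] := MVT t0 dh ch.
rewrite mul0r /h mulr0 expR0 mul1r w0 => /eqP; rewrite subr_eq0 => /eqP <-.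
by rewrite mulrA -expRD addrC subrr expR0 mul1r.
Qed.

Lemma koopman_phi_flow m (nu : m.+1.-tuple nat) t : 0 <= t ->
  koopman_phi e nu (w t) = expR (- (koopman_rate lam nu * t)) * koopman_phi e nu u0.
Proof.
move=> t0; rewrite !koopman_phiE; [|exact: eigen_cont01..].
transitivity (\prod_(i < m.+1)
    (expR (- ((lam (tnth nu i) - lam 0) * t)) * rho (tnth nu i) u0)).
  by apply: eq_bigr => i _; exact: koopman_ratio.
rewrite big_split/= -expR_sum; congr (expR _ * _).
by rewrite /koopman_rate mulr_suml -sumrN.
Qed.

End koopman_flow.

(** * Non-vanishing of the eigen-observables *)

Section L2_construct.
Variable R : realType.

(** The bound is asked only almost everywhere because it is applied to the chosen representative of
    a class, about which nothing more is known. *)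
Lemma ae_bounded_finite_norm2 d (T : measurableType d)
    (P : {measure set T -> \bar R}) (f : T -> R) (M : R) :
    P setT = 1%E -> measurable_fun setT f -> 0 <= M ->
    {ae P, forall x, `|f x| <= M} -> finite_norm P 2%:E f.
Proof.
move=> P1 mf M0 fM; rewrite /finite_norm unlock /Lnorm poweR_lty//.
apply: (@le_lt_trans _ _ (\int[P]_x (M `^ 2)%:E)%E); last first.
  by rewrite integral_cst// P1 mule1 ltry.
apply: ae_ge0_le_integral => //.
- by move=> x _; rewrite lee_fin powR_ge0.
- apply/measurable_EFinP.
  apply: (@measurableT_comp _ _ _ _ _ _ (@powR R ^~ 2)) => //.
  exact: measurableT_comp.
- by move=> x _; rewrite lee_fin powR_ge0.
- by apply: filterS fM => x fxM _; rewrite lee_fin ge0_ler_powR// nnegrE.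
Qed.

Lemma L2_of_bounded (f : R -> R) (M : R) :
    measurable_fun setT (f : measurableTypeR R -> measurableTypeR R) ->
    0 <= M -> (forall x, `|f x| <= M) ->
  exists u : L2 R, L2_fun u = f %[ae @leb01 R].
Proof.
move=> mf M0 fM.
pose F : {mfun measurableTypeR R >-> measurableTypeR R} :=
  HB.pack f (@isMeasurableFun.Build _ _ (measurableTypeR R) (measurableTypeR R) f mf).
pose c : {mfun_ (@leb01 R), _ >-> measurableTypeR R} := (\pi F)%qT.
have cF : (c : R -> R) = f %[ae @leb01 R].
  have : (repr c = F %[mod {mfun_ (@leb01 R), _ >-> measurableTypeR R}])%qT.
    by rewrite reprK.
  by move/eqmodP => /asboolP.
have fin : finite_norm (@leb01 R) 2%:E (c : R -> R).
  apply: (@ae_bounded_finite_norm2 _ _ (@leb01 R) _ M) => //.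
  - exact: leb01_setT.
  - exact: (@measurable_funPT _ _ _ _ (repr c)).
  - apply: (@filterS _ _ (ae_filter_ringOfSetsType (@leb01 R)) _ _ _ cF).
    by move=> x /= ->.
pose u : L2 R := HB.pack_for (L2 R) c
  (@isFinLebesgue.Build _ _ _ (@leb01 R) 2%:E (lee1n 2) c fin).
by exists u.
Qed.

Lemma L2_of_cont01 (f : R -> R) : cont01 f ->
  exists u : L2 R, L2_fun u = f %[ae @leb01 R].
Proof.
move=> cf; have [M M0 HM] := cont01_bounded cf.
(* Extension by zero makes f bounded and measurable on the whole line; [leb01] ignores the
   complement of [0, 1]. *)
have [||u uf] := @L2_of_bounded (f \_ `[0, 1]) M _ M0.
- apply/(measurable_restrictT f) => //.
  exact: subspace_continuous_measurable_fun.
- move=> x; rewrite patchE; case: ifPn => [|_]; last by rewrite normr0.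
  by rewrite inE => /HM.
exists u.
have ae01 : {ae @leb01 R, forall x, x \in `[0, 1]}.
  exists (~` `[0, 1]%classic); split => //=; first exact: measurableC.
  by rewrite /leb01/= /mrestr setICl measure0.
apply: (@filterS2 _ _ (ae_filter_ringOfSetsType (@leb01 R)) _ _ _ _ uf ae01).
by move=> x /= ux x01 _; rewrite ux// patchE mem_set.
Qed.

End L2_construct.

(** * Inversion of the Cole-Hopf transform and a point where the observable is nonzero *)

Section witness.
Variable R : realType.
Notation mu := (@lebesgue_measure R).
Implicit Types (v : R -> R) (x y : R).

(* The Cole-Hopf transform is inverted by u = - 2 v' / v. *)
Lemma cole_hopf_onto v (v' : R -> R) : (forall x, x \in `[0, 1] -> 0 < v x) ->
    cont01 v -> cont01 v' ->
    (forall x, x \in `]0, 1[ -> is_derive x 1 v (v' x)) ->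
  exists u : L2 R, forall x, x \in `[0, 1] -> chopf u x = v x / v 0.
Proof.
move=> v0 cv cv' dv.
pose f x := - (2 * (v' x / v x)).
have cf : cont01 f.
  apply/cont01_opp/cont01_mul; first exact: cont01_cst.
  by apply: cont01_mul => //; apply: cont01_inv => // x x01; rewrite gt_eqF ?v0.
have [u uf] := L2_of_cont01 cf.
exists u => y y01; rewrite /chopf (L2_Rintegral_ae y01 cf uf).
(* By the choice of [f] the derivative of [K] vanishes, so [K y] equals [K 0], which is [v 0]. *)
pose K x := v x * expR (2^-1 * \int[mu]_(s in `[0, x]) f s).
have cK : cont01 K.
  apply: cont01_mul => //; apply: (@cont01_comp _ expR); first exact: continuous_expR.
  by apply: cont01_mul; [exact: cont01_cst|exact: cont01_primitive].
have dK x : x \in `]0, 1[ -> is_derive x 1 K 0.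
  move=> x01; have x01' : x \in `[0, 1] by exact: subset_itv_oo_cc.
  have dvx := dv x x01.
  have dI := is_derive_primitive01 x01 cf.
  rewrite /K; apply: is_derive_eq; rewrite /GRing.scale/= /f.
  by field; rewrite gt_eqF ?v0.
have := FTC01 y01 (@cont01_cst _ 0) cK dK.
rewrite Rintegral01_cst// mul0r /K set_itv1 Rintegral_set1 mulr0 expR0 mulr1.
move=> /esym/eqP; rewrite subr_eq0 => /eqP <-.
by rewrite expRN invfM mulrA divff ?mul1r// gt_eqF ?v0.
Qed.

Lemma int01_add (f g : R -> R) : cont01 f -> cont01 g ->
  int01 (fun x => f x + g x) = int01 f + int01 g.
Proof.
move=> cf cg; have h1 : 1 \in `[0, 1 : R] by rewrite in_itv/= ler01 lexx.
by rewrite /int01 RintegralD//; exact: cont01_integrable.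
Qed.

Lemma int01_scale (c : R) (f : R -> R) : cont01 f ->
  int01 (fun x => c * f x) = c * int01 f.
Proof.
move=> cf; have h1 : 1 \in `[0, 1 : R] by rewrite in_itv/= ler01 lexx.
by rewrite /int01 RintegralZl//; exact: cont01_integrable.
Qed.

Lemma int01_sum n (f : 'I_n -> R -> R) : (forall i, cont01 (f i)) ->
  int01 (fun x => \sum_i f i x) = \sum_i int01 (f i).
Proof.
elim: n f => [|n ih] f cf.
  under [fun x => _]funext => x do rewrite big_ord0.
  have h1 : 1 \in `[0, 1 : R] by rewrite in_itv/= ler01 lexx.
  by rewrite big_ord0 /int01 Rintegral01_cst// mul0r.
under [fun x => _]funext => x do rewrite big_ord_recl.
by rewrite int01_add ?ih ?big_ord_recl//; exact: cont01_sum.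
Qed.

Variables (V : R -> R) (lam : nat -> R) (e : nat -> R -> R).
Hypothesis eP : neumann_eigenbasis V lam e.

(** For data whose transform is proportional to [v], orthonormality makes every coefficient in the
    product positive, in numerators and denominators alike. *)
Lemma koopman_phi_neq0 m (nu : m.+1.-tuple nat) :
  (forall i, (0 < tnth nu i)%N) -> exists u, koopman_phi e nu u != 0.
Proof.
move=> nu0.
have ce := eigen_cont01 eP; have ce' := eigen_deriv_cont01 eP.
have e0 := eigen0_gt0 eP.
have [[d1 _ _ _] orth _ _ _] := eP.
pose S x := \sum_(i < m.+1) e (tnth nu i) x.
have cS : cont01 S by apply: cont01_sum => i; exact: ce.
have [B B0 HB] := cont01_bounded cS.
have [c c01 Hc] := EVT_min ler01 (ce 0%N).
(* With [e 0 c] the minimum of the ground state and |S| <= B, this gives eps |S| < [e 0 c], hence v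
   > 0; the added 1 covers B = 0. *)
pose eps := e 0 c / (B + 1).
have B1 : 0 < B + 1 by rewrite ltr_wpDl.
have eps0 : 0 < eps by rewrite divr_gt0// e0.
pose v x := e 0 x + eps * S x.
have v0 x : x \in `[0, 1] -> 0 < v x.
  move=> x01; have /= := Hc x x01; have := HB x x01.
  rewrite ler_norml => /andP[SB _] ec.
  have : eps * - B <= eps * S x by rewrite ler_pM2l.
  have : eps * (B + 1) = e 0 c by rewrite /eps divfK// gt_eqF.
  by rewrite /v; lra.
pose v' x := deriv01 (e 0) x + eps * \sum_(i < m.+1) deriv01 (e (tnth nu i)) x.
have cv : cont01 v by apply: cont01_add => //; exact: cont01_mul (@cont01_cst _ _) cS.
have cv' : cont01 v'.
  apply: cont01_add => //; apply: cont01_mul; first exact: cont01_cst.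
  by apply: cont01_sum => i.
have dv x : x \in `]0, 1[ -> is_derive x 1 v (v' x).
  move=> x01; have x01' : x \in `[0, 1] by exact: subset_itv_oo_cc.
  have de n := derivable01_is_derive x01 (d1 n x x01').
  have dS : is_derive x 1 S (\sum_(i < m.+1) deriv01 (e (tnth nu i)) x).
    rewrite (_ : S = \sum_(i < m.+1) e (tnth nu i)); first exact: is_derive_sum.
    by apply/funext => y; rewrite fct_sumE.
  by rewrite /v /v'; apply: is_derive_eq.
have [u uv] := cole_hopf_onto v0 cv cv' dv.
have v00 : 0 < v 0 by apply: v0; rewrite in_itv/= lexx ler01.
exists u; rewrite koopman_phiE//; apply/prodf_neq0 => i _.
suff coef_gt0 n : (n = 0)%N \/ (exists i, n = tnth nu i) -> 0 < coef e n (chopf u).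
  by rewrite mulf_neq0 ?invr_eq0// gt_eqF// coef_gt0//; [right; exists i|left].
move=> hn.
have -> : coef e n (chopf u) =
    int01 (fun x => (v 0)^-1 * (e n x * e 0 x
       + eps * \sum_i e n x * e (tnth nu i) x)).
  apply: eq_Rintegral => x; rewrite inE => x01.
  by rewrite uv// /v /S -mulr_sumr; ring.
have cee k : cont01 (fun x => e n x * e k x) by exact: cont01_mul.
have ces : cont01 (fun x => \sum_i e n x * e (tnth nu i) x).
  by apply: cont01_sum => j; exact: cee.
have ces' : cont01 (fun x => eps * \sum_i e n x * e (tnth nu i) x).
  by apply: cont01_mul => //; exact: cont01_cst.
rewrite int01_scale; last exact: cont01_add.
rewrite int01_add// int01_scale// int01_sum; last by move=> j; exact: cee.
rewrite orth; under eq_bigr do rewrite orth.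
rewrite mulr_gt0 ?invr_gt0//.
case: hn => [->|[j ->]].
  by rewrite eqxx ltr_wpDr// (mulr_ge0 (ltW eps0))// sumr_ge0.
(* The [e 0] part is orthogonal since the index is positive. Indices may repeat: the term [j]
   contributes 1 and the others are nonnegative. *)
rewrite gtn_eqF ?nu0// add0r mulr_gt0//.
by rewrite (bigD1 j)//= eqxx ltr_wpDr// sumr_ge0.
Qed.

End witness.

Unset Implicit Arguments.
Set Strict Implicit.
Set Printing Implicit Defensive.

Theorem mainTheorem4 (R : realType) (V : R -> R)
    (V_smooth : smooth01 V)
    (V_gt0 : forall x : R, x \in `[0, 1] -> 0 < V x)
    (Phi : R -> L2 R -> L2 R) (Phi_flow : burgers_flow V Phi)
    (mu : nat -> R) (e : nat -> R -> R)
    (mu_e : neumann_eigenbasis V mu e)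
    (m : nat) (nu : m.+1.-tuple nat)
    (nu_gt0 : forall i, (0 < tnth nu i)%N)
    (t : R) (t_ge0 : 0 <= t) :
  eigen_observable (koopman Phi t) (expR (- (koopman_rate mu nu * t)))
    (koopman_phi e nu).
Proof.
have ce := eigen_cont01 mu_e.
split.
- exact: koopman_phi_continuous ce (eigen0_gt0 mu_e).
- exact: koopman_phi_neq0 mu_e _ nu nu_gt0.
- by apply/funext => u; exact: (koopman_phi_flow V_smooth mu_e (Phi_flow u) nu t_ge0).
Qed.
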